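(* Let $\alpha$ be a composition. Call two standard lexical tableaux of shape $\alpha$ row-equivalent if, for each $i$, their $i$-th rows contain the same set of labels. Then the number of equivalence classes of standard lexical tableaux of shape $\alpha$ under row-equivalence equals the number of standard immaculate tableaux of shape $\alpha$.
   Context: A composition $\alpha \vDash n$ is a tuple of positive integers summing to $n$; its diagram has left-justified rows, row $i$ (from the bottom) having $\alpha_i$ cells. A word $w=w_1\cdots w_m$ is a necklace word if it is lexicographically weakly smallest among all its cyclic shifts $w_{i+1}\cdots w_m w_1\cdots w_i$. A standard lexical tableau of shape $\alpha$ is a filling of the diagram of $\alpha$ with $1,\dots,n$, each used once, such that the first column strictly increases from the bottom row upward and each row, read left to right, is a necklace word. A standard immaculate tableau of shape $\alpha$ is a filling of the diagram with $1,\dots,n$, each used once, with strictly increasing first column (from bottom upward) and each row increasing left to right. *)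

(* Defs.v *)
From mathcomp Require Import all_boot all_order.

Set Implicit Arguments.
Unset Strict Implicit.
Unset Printing Implicit Defensive.

Definition is_composition (alpha : seq nat) : bool := all (ltn 0) alpha.

(* Rows are numbered from 0, from the bottom to the top; columns are numbered *)
(* from 0, from left to right.                                                *)
Definition cell (alpha : seq nat) : finType :=
  {i : 'I_(size alpha) & 'I_(nth 0 alpha i)}.

Definition mkcell (alpha : seq nat) (i : 'I_(size alpha))
  (j : 'I_(nth 0 alpha i)) : cell alpha :=
  Tagged (fun i : 'I_(size alpha) => 'I_(nth 0 alpha i)) j.

Definition cell_row (alpha : seq nat) (c : cell alpha) : nat := tag c.
Definition cell_col (alpha : seq nat) (c : cell alpha) : nat := tagged c.

(* T c = k : 'I_n stands for the label k.+1, with n = sumn alpha.             *)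
Definition filling (alpha : seq nat) : finType :=
  {ffun cell alpha -> 'I_(sumn alpha)}.

Definition label (alpha : seq nat) (T : filling alpha) (c : cell alpha) : nat :=
  (T c).+1.

Definition standard (alpha : seq nat) (T : filling alpha) : bool :=
  [forall k : 'I_(sumn alpha), #|[set c | label T c == k.+1]| == 1].

Definition row_word (alpha : seq nat) (T : filling alpha)
  (i : 'I_(size alpha)) : seq nat :=
  [seq label T (mkcell j) | j <- enum 'I_(nth 0 alpha i)].

Definition first_column_increasing (alpha : seq nat) (T : filling alpha) : bool :=
  [forall c : cell alpha, forall c' : cell alpha,
    [&& cell_col c == 0, cell_col c' == 0 & cell_row c < cell_row c']
      ==> (label T c < label T c')].

Definition is_necklace (w : seq nat) : bool :=
  all (fun i => ((w : seqlexi nat) <= (rot i w : seqlexi nat))%O)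
      (iota 0 (size w)).

Definition lexical_tableaux (alpha : seq nat) : {set filling alpha} :=
  [set T | [&& standard T, first_column_increasing T
             & [forall i, is_necklace (row_word T i)]]].

Definition immaculate_tableaux (alpha : seq nat) : {set filling alpha} :=
  [set T | [&& standard T, first_column_increasing T
             & [forall i, sorted ltn (row_word T i)]]].

(* Sets of shifted labels: k : 'I_n stands for the label k.+1.                *)
Definition row_labels (alpha : seq nat) (T : filling alpha)
  (i : 'I_(size alpha)) : {set 'I_(sumn alpha)} :=
  [set T (mkcell j) | j : 'I_(nth 0 alpha i)].

Definition row_equiv (alpha : seq nat) : rel (filling alpha) :=
  fun T T' => [forall i, row_labels T i == row_labels T' i].

Lemma row_equiv_equivalence (alpha : seq nat) :
  equivalence_rel (@row_equiv alpha).
Proof.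
move=> T T' T''; split; first by apply/forallP=> i.
by move=> /forallP e; apply: eq_forallb => i; rewrite (eqP (e i)).
Qed.

(* Main.v *)
Require Import Defs.
From mathcomp Require Import all_boot all_order.

(** A row with distinct labels is a necklace word exactly when its first label
    is its least one. Hence sorting every row of a standard lexical tableau
    fixes the first column and yields the unique immaculate tableau of its
    row-equivalence class; conversely immaculate tableaux are lexical. *)

Set Implicit Arguments.
Unset Strict Implicit.
Unset Printing Implicit Defensive.

Import Order.TTheory.

(** A nontrivial rotation starts with a later entry, which is strictly greater than the head, so the
    first letters already decide the comparison. *)
Lemma sorted_is_necklace (w : seq nat) : sorted ltn w -> is_necklace w.
Proof.
case: w => [//|x s] /= sx; apply/allP => i; rewrite mem_iota add0n => /andP[_ ilt].
case: i ilt => [|i] ilt; first by rewrite rot0 lexx.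
have := order_path_min ltn_trans sx => /allP xmin.
rewrite /rot /= (drop_nth x) //= lexi_cons.
have lt_x : x < nth x s i by apply: xmin; rewrite mem_nth.
by rewrite !leEnat (ltnW lt_x) leqNgt lt_x.
Qed.

(** Rotating [y] to the front and comparing first letters gives the bound. *)
Lemma is_necklace_head_min (x : nat) (s : seq nat) :
  is_necklace (x :: s) -> {in x :: s, forall y, x <= y}.
Proof.
move=> /allP nck y ys.
have := nck (index y (x :: s)); rewrite mem_iota index_mem ys => /(_ isT).
by rewrite rot_index // lexi_cons leEnat => /andP[].
Qed.

Section Rows.

Variable alpha : seq nat.
Implicit Types (T : filling alpha) (i : 'I_(size alpha)) (c : cell alpha).

(** Unshifted ordinals are kept here, so that a row can be compared directly with the enumeration of
    its [row_labels]. *)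
Definition row_seq T i : seq 'I_(sumn alpha) :=
  [seq T (mkcell j) | j <- enum 'I_(nth 0 alpha i)].

Lemma row_wordE T i : row_word T i = [seq (val k).+1 | k <- row_seq T i].
Proof. exact: (map_comp (fun k : 'I__ => (val k).+1)). Qed.

Lemma size_row_seq T i : size (row_seq T i) = nth 0 alpha i.
Proof. by rewrite size_map size_enum_ord. Qed.

Lemma mem_row_seq T i : row_seq T i =i row_labels T i.
Proof.
move=> k; apply/mapP/imsetP => -[j _ ->]; exists j => //.
by rewrite mem_enum.
Qed.

Lemma nth_row_seq T c k0 : nth k0 (row_seq T (tag c)) (tagged c) = T c.
Proof.
case: c => i j /=.
by rewrite (nth_map j) ?size_enum_ord // nth_ord_enum.
Qed.

Lemma mem_row_labels T c : T c \in row_labels T (tag c).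
Proof. by case: c => i j; apply/imsetP; exists j. Qed.

Lemma row_labelsP T i k :
  reflect (exists2 c, tag c = i & k = T c) (k \in row_labels T i).
Proof.
apply: (iffP imsetP) => [[j _ ->]|[c <- ->]]; first by exists (mkcell j).
by case: c => i' j; exists j.
Qed.

Lemma eq_filling_row_seq T T' : (forall i, row_seq T i = row_seq T' i) -> T = T'.
Proof.
by move=> e; apply/ffunP => c; rewrite -(nth_row_seq T c (T c)) e nth_row_seq.
Qed.

Lemma sorted_row_wordE T i :
  sorted ltn (row_word T i) = sorted ltn (map val (row_seq T i)).
Proof. by rewrite row_wordE !sorted_map. Qed.

Lemma sorted_enum_ord_set n (A : {set 'I_n}) : sorted ltn (map val (enum A)).
Proof.
rewrite sorted_map; apply: sorted_filter; first by move=> ? ? ?; apply: ltn_trans.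
by rewrite -enumT; have := iota_ltn_sorted 0 n; rewrite -val_enum_ord sorted_map.
Qed.

(** A strictly increasing sequence is determined by its set of entries; this is what makes an
    immaculate tableau unique in its class. *)
Lemma sorted_row_seq T i :
  sorted ltn (row_word T i) -> row_seq T i = enum (row_labels T i).
Proof.
rewrite sorted_row_wordE => sT; apply: (inj_map val_inj).
apply: (irr_sorted_eq ltn_trans ltnn sT (sorted_enum_ord_set _)).
by apply/eq_mem_map => k; rewrite mem_row_seq mem_enum.
Qed.

Lemma standardP T :
  reflect (injective T /\ forall k, exists c, T c = k) (standard T).
Proof.
apply: (iffP forallP) => [std|[injT surjT] k]; last first.
  have [c <-] := surjT k; apply/cards1P; exists c; apply/setP => c'.
  by rewrite !inE /label eqSS (inj_eq val_inj) (inj_eq injT).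
have cell_of k : exists c, [set c' | T c' == k] = [set c].
  have /cards1P[c e] := std k; exists c; rewrite -e; apply/setP => c'.
  by rewrite !inE.
split=> [c c' ecc'|k].
  have [d /setP e] := cell_of (T c).
  move: (e c) (e c'); rewrite !inE -ecc' eqxx.
  by move=> /esym/eqP-> /esym/eqP->.
have [c /setP/(_ c)] := cell_of k.
by rewrite !inE eqxx => /eqP <-; exists c.
Qed.

Lemma card_row_labels T i : injective T -> #|row_labels T i| = nth 0 alpha i.
Proof.
move=> injT; rewrite card_imset ?card_ord // => j j' /injT/eqP.
by rewrite eq_Tagged => /eqP.
Qed.

(** The default [T c] supplies an element of a possibly empty ordinal type. It is never reached for
    injective [T], whose row sets have as many elements as the rows have cells. *)
Definition sort_rows T : filling alpha :=
  [ffun c => nth (T c) (enum (row_labels T (tag c))) (tagged c)].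

Lemma row_seq_sort_rows T i :
  injective T -> row_seq (sort_rows T) i = enum (row_labels T i).
Proof.
move=> injT; have sz : size (enum (row_labels T i)) = nth 0 alpha i.
  by rewrite -cardE card_row_labels.
(* An empty row has no cell whose entry could serve as default for [nth], so it is treated apart. *)
case: (posnP (nth 0 alpha i)) => [z|pos].
  apply: (etrans (size0nil _) (esym (size0nil _))); last by rewrite sz.
  by rewrite size_row_seq.
pose k0 := T (mkcell (Ordinal pos)).
apply: (@eq_from_nth _ k0) => [|j]; rewrite size_row_seq ?sz // => jlt.
rewrite -[j]/(nat_of_ord (tagged (mkcell (Ordinal jlt)))).
rewrite (nth_row_seq _ (mkcell (Ordinal jlt))) ffunE /=.
by apply: set_nth_default; rewrite sz.
Qed.

Lemma row_labels_sort_rows T i :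
  injective T -> row_labels (sort_rows T) i = row_labels T i.
Proof.
move=> injT; apply/setP => k.
by rewrite -mem_row_seq row_seq_sort_rows // mem_enum.
Qed.

(** Distinct rows of an injective filling have disjoint label sets, so equal entries lie in the same
    row; there the columns agree because [enum] has no duplicates. *)
Lemma sort_rows_inj T : injective T -> injective (sort_rows T).
Proof.
move=> injT c c' e.
have etag : tag c = tag c'.
  have := mem_row_labels (sort_rows T) c'; rewrite -e.
  have := mem_row_labels (sort_rows T) c.
  rewrite !row_labels_sort_rows // => /row_labelsP[d <- ->].
  by case/row_labelsP => d' <- /injT ->.
case: c c' etag e => i j [i' j'] /= ii'; case: i' / ii' j' => j' e.
congr existT; apply/val_inj/eqP.
rewrite -(nth_uniq (T (mkcell j)) _ _ (enum_uniq (row_labels T i)));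
  rewrite -?cardE ?card_row_labels ?ltn_ord //.
rewrite -(row_seq_sort_rows _ injT).
by rewrite (nth_row_seq _ (mkcell j)) (nth_row_seq _ (mkcell j')) e.
Qed.

Lemma sort_rows_standard T : standard T -> standard (sort_rows T).
Proof.
case/standardP => injT surjT; apply/standardP; split; first exact: sort_rows_inj.
move=> k; have [c <-] := surjT k; have := mem_row_labels T c.
by rewrite -row_labels_sort_rows // => /row_labelsP[d _ ->]; exists d.
Qed.

Lemma necklace_row_min T c k :
  is_necklace (row_word T (tag c)) -> cell_col c = 0 ->
  k \in row_labels T (tag c) -> T c <= k.
Proof.
rewrite row_wordE /cell_col -mem_row_seq => nck c0 kin.
have := nth_row_seq T c k; rewrite c0.
case: (row_seq T (tag c)) nck kin => // x s nck kin /= <-.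
(* Adding one to both sides passes from ordinals to the labels of [row_word]. *)
rewrite -ltnS; apply: (is_necklace_head_min nck).
exact: (map_f (fun k : 'I__ => (val k).+1)) kin.
Qed.

(** Both entries are the least element of the same row set, one by the necklace condition and the
    other by sortedness, so each is at most the other. *)
Lemma sort_rows_first_column T c :
    injective T -> is_necklace (row_word T (tag c)) -> cell_col c = 0 ->
  sort_rows T c = T c.
Proof.
move=> injT nck c0; apply/val_inj/eqP; rewrite /= eqn_leq; apply/andP; split.
  apply: necklace_row_min => //.
    apply: sorted_is_necklace; rewrite sorted_row_wordE row_seq_sort_rows //.
    exact: sorted_enum_ord_set.
  by rewrite row_labels_sort_rows // mem_row_labels.
by apply: necklace_row_min => //; rewrite -row_labels_sort_rows // mem_row_labels.
Qed.

Lemma sort_rows_immaculate T :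
  T \in lexical_tableaux alpha -> sort_rows T \in immaculate_tableaux alpha.
Proof.
rewrite !inE => /and3P[std /forallP col /forallP nck].
have [injT _] := standardP _ std.
rewrite sort_rows_standard //=; apply/andP; split.
  apply/forallP => c; apply/forallP => c'; apply/implyP => /and3P[c0 c0' lt].
  have /forallP/(_ c') := col c; rewrite c0 c0' lt /label /=.
  by rewrite !sort_rows_first_column //; apply/eqP.
apply/forallP => i; rewrite sorted_row_wordE row_seq_sort_rows //.
exact: sorted_enum_ord_set.
Qed.

Lemma immaculate_lexical T :
  T \in immaculate_tableaux alpha -> T \in lexical_tableaux alpha.
Proof.
rewrite !inE => /and3P[-> -> /forallP sT] /=.
by apply/forallP => i; apply: sorted_is_necklace.
Qed.

Lemma immaculate_row_equiv_eq T T' :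
    T \in immaculate_tableaux alpha -> T' \in immaculate_tableaux alpha ->
  row_equiv T T' -> T = T'.
Proof.
rewrite !inE => /and3P[_ _ /forallP sT] /and3P[_ _ /forallP sT'] /forallP e.
by apply: eq_filling_row_seq => i; rewrite !sorted_row_seq // (eqP (e i)).
Qed.

End Rows.

Theorem theorem3p6 (alpha : seq nat) (halpha : is_composition alpha) :
  #|equivalence_partition (@row_equiv alpha) (lexical_tableaux alpha)|
  = #|immaculate_tableaux alpha|.
Proof.
(* The partition is the image of the lexical tableaux under [class]. It remains to see that [class]
   is injective on immaculate tableaux and has the same image there. *)
pose class T := [set T' in lexical_tableaux alpha | row_equiv T T'].
have equiv := @row_equiv_equivalence alpha.
have class_inj : {in immaculate_tableaux alpha &, injective class}.
  (* By reflexivity [T'] lies in its own class, hence in that of [T]. *)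
  move=> T T' immT immT' /setP/(_ T'); rewrite !in_set (equiv T' T' T').1 andbT.
  have := immaculate_lexical immT'; rewrite inE => ->.
  by move=> /= e; apply: immaculate_row_equiv_eq => //; rewrite e.
rewrite -(card_in_imset class_inj); apply: eq_card => A.
apply/imsetP/imsetP => -[T hT ->]; last first.
  by exists T; first exact: immaculate_lexical.
(* Sorting preserves the row sets, so [T] and [sort_rows T] have the same class. *)
exists (sort_rows T); first exact: sort_rows_immaculate.
have [injT _] : injective T /\ forall k, exists c, T c = k.
  by apply/standardP; move: hT; rewrite inE => /and3P[].
apply/setP => T'; rewrite !in_set; congr (_ && _).
by apply: eq_forallb => i; rewrite row_labels_sort_rows.
Qed.
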